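(* Let $w$ be an infinite ternary square-free word and let $x\in\{a,b,c\}$ be a letter. Then the lower and upper frequencies $f^-$ and $f^+$ of $x$ in $w$ satisfy $$\frac{31}{117}\;\le\; f^-\;\le\; f^+\;\le\;\frac{39}{97}.$$
   Context: Words are strings over the alphabet $\{a,b,c\}$. A (finite or infinite) word $w$ is square-free if it contains no factor of the form $yy$ with $y$ a nonempty finite word. For an infinite word $w$ and a letter $x$, let $x_n^{+}$ (resp. $x_n^{-}$) be the maximum (resp. minimum) number of occurrences of $x$ in a length-$n$ factor (contiguous subword) of $w$. The upper and lower frequencies of $x$ in $w$ are $f^{\pm}=\lim_{n\to\infty}x_n^{\pm}/n$ (these limits exist). *)

(* Defs.v *)
From HB Require Import structures.
From mathcomp Require Import all_boot all_order all_algebra.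
From mathcomp Require Import all_classical all_reals all_analysis.

Set Implicit Arguments.
Unset Strict Implicit.
Unset Printing Implicit Defensive.

Import Order.TTheory GRing.Theory Num.Theory.
Import numFieldNormedType.Exports.

Local Open Scope ring_scope.
Local Open Scope classical_set_scope.

(* A (right-)infinite word over T is a map nat -> T. *)
Definition factor (T : Type) (w : nat -> T) (i n : nat) : seq T :=
  mkseq (fun k => w (i + k)%N) n.

Definition is_factor (T : Type) (w : nat -> T) (u : seq T) : Prop :=
  exists i, u = factor w i (size u).

Definition square_free (T : Type) (w : nat -> T) : Prop :=
  forall y : seq T, y <> [::] -> ~ is_factor w (y ++ y).

Definition max_occ (T : finType) (w : nat -> T) (x : T) (n : nat) : nat :=
  \max_(u : n.-tuple T | `[< is_factor w u >]) count_mem x u.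

(* The default value n of the iterated minimum does not matter: the range is
   nonempty and every term is at most n (see min_occP). *)
Definition min_occ (T : finType) (w : nat -> T) (x : T) (n : nat) : nat :=
  \big[Order.min/n]_(u : n.-tuple T | `[< is_factor w u >]) count_mem x u.

Definition upper_freq (R : realType) (T : finType) (w : nat -> T) (x : T) : R :=
  limn (fun n => (max_occ w x n)%:R / n%:R : R).

Definition lower_freq (R : realType) (T : finType) (w : nat -> T) (x : T) : R :=
  limn (fun n => (min_occ w x n)%:R / n%:R : R).

Lemma size_factor (T : Type) (w : nat -> T) i n : size (factor w i n) = n.
Proof. exact: size_mkseq. Qed.

Lemma factorD (T : Type) (w : nat -> T) i m n :
  factor w i (m + n) = factor w i m ++ factor w (i + m) n.
Proof.
rewrite /factor /mkseq iotaD map_cat add0n; congr (_ ++ _).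
rewrite -[X in iota X n](addn0 m) iotaDl -map_comp.
by apply: eq_map => k /=; rewrite addnA.
Qed.

Lemma is_factorP (T : Type) (w : nat -> T) n (u : n.-tuple T) :
  is_factor w u <-> exists i, u = factor w i n :> seq T.
Proof. by rewrite /is_factor size_tuple. Qed.

Lemma max_occP (T : finType) (w : nat -> T) (x : T) n :
  (forall i, (count_mem x (factor w i n) <= max_occ w x n)%N) /\
  exists i, count_mem x (factor w i n) = max_occ w x n.
Proof.
have fE i : mktuple (fun k : 'I_n => w (i + k)%N) = factor w i n :> seq T.
  by rewrite /factor /mkseq /= -val_enum_ord -map_comp; apply: eq_map.
have ft i : `[< is_factor w (mktuple (fun k : 'I_n => w (i + k)%N)) >].
  by apply/asboolP/is_factorP; exists i; rewrite fE.
split=> [i|]; first by rewrite -fE (leq_bigmax_cond _ (ft i)).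
rewrite /max_occ (bigop.bigmax_eq_arg _ (ft 0%N)).
case: arg_maxnP => [|u /asboolP/is_factorP[i ui] _]; first exact: ft.
by exists i; rewrite -ui.
Qed.

Lemma min_occP (T : finType) (w : nat -> T) (x : T) n :
  (forall i, (min_occ w x n <= count_mem x (factor w i n))%N) /\
  exists i, count_mem x (factor w i n) = min_occ w x n.
Proof.
have fE i : mktuple (fun k : 'I_n => w (i + k)%N) = factor w i n :> seq T.
  by rewrite /factor /mkseq /= -val_enum_ord -map_comp; apply: eq_map.
have ft i : `[< is_factor w (mktuple (fun k : 'I_n => w (i + k)%N)) >].
  by apply/asboolP/is_factorP; exists i; rewrite fE.
have lb i : (min_occ w x n <= count_mem x (factor w i n))%N.
  by rewrite -fE -leEnat /min_occ; exact: bigmin_le_cond (ft i).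
split=> //.
have : min_occ w x n = n \/ exists i, count_mem x (factor w i n) = min_occ w x n.
  rewrite /min_occ; elim/big_ind: _ => [|a b IHa IHb|u /asboolP/is_factorP[i ui]].
  - by left.
  - by rewrite /Order.min; case: ifP.
  - by right; exists i; rewrite -ui.
case=> // minn; exists 0%N; apply/eqP; rewrite eqn_leq lb andbT minn.
by rewrite -{2}(size_factor w 0 n) count_size.
Qed.

(* Fekete's lemma, for a sequence of naturals bounded by the identity. *)
Lemma fekete (R : realType) (a : nat -> nat) :
  (forall n, (a n <= n)%N) -> (forall m n, (a (m + n) <= a m + a n)%N) ->
  cvgn (fun n => (a n)%:R / n%:R : R).
Proof.
move=> an asub.
have amul q n r : (a (q * n + r) <= q * a n + r)%N.
  elim: q => [|q IH]; first by rewrite !mul0n !add0n an.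
  by rewrite !mulSn -!addnA (leq_trans (asub _ _)) // leq_add2l.
pose A := (fun n => (a n)%:R / n%:R : R) @` [set k : nat | (0 < k)%N].
have Ainf : has_inf A.
  split; first by exists ((a 1%N)%:R / 1%:R); exists 1%N.
  by exists 0 => _ [n _ <-]; rewrite divr_ge0.
apply/cvg_ex; exists (inf A); apply/cvgrPdist_lt => /= e e0.
have e20 : 0 < e / 2 by rewrite divr_gt0.
have [_ [n /= n0 <-] nL] := inf_adherent e20 Ainf.
have [N _ HN] : \forall m \near \oo, n%:R / m%:R < e / 2 :> R.
  near=> m.
  have m0 : 0 < m%:R :> R by rewrite ltr0n; near: m; exists 1%N.
  rewrite ltr_pdivrMr // mulrC -ltr_pdivrMr //.
  by near: m; exact: nbhs_infty_gtr.
near=> m.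
have m0 : (0 < m)%N by near: m; exists 1%N.
have mR : 0 < m%:R :> R by rewrite ltr0n.
have nR : 0 < n%:R :> R by rewrite ltr0n.
have Lm : inf A <= (a m)%:R / m%:R by apply: (ge_inf Ainf.2); exists m.
rewrite distrC ger0_norm ?subr_ge0 // ltrBlDl.
have -> : inf A + e = inf A + e / 2 + e / 2 by rewrite -addrA -splitr.
have mN : n%:R / m%:R < e / 2 :> R by apply: HN => /=; near: m; exists N.
apply: le_lt_trans (ltrD nL mN).
rewrite ler_pdivrMr // mulrDl divfK ?gt_eqF //.
have /(leq_trans _) : (m %/ n * a n + m %% n <= m %/ n * a n + n)%N.
  by rewrite leq_add2l ltnW // ltn_pmod.
have := amul (m %/ n)%N n (m %% n)%N; rewrite -divn_eq => am /(_ _ am).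
rewrite -(ler_nat R) natrD natrM => /le_trans; apply.
rewrite lerD2r [leRHS]mulrAC ler_pdivlMr // -!natrM ler_nat.
by rewrite mulnAC mulnC leq_mul2l leq_divM orbT.
Unshelve. all: by end_near. Qed.

Lemma cvg_upper_freq (R : realType) (T : finType) (w : nat -> T) (x : T) :
  cvgn (fun n => (max_occ w x n)%:R / n%:R : R).
Proof.
apply: fekete => [n|m n].
  have [i <-] := (max_occP w x n).2.
  by rewrite -{2}(size_factor w i n) count_size.
have [i <-] := (max_occP w x (m + n)).2.
by rewrite factorD count_cat leq_add // (max_occP w x _).1.
Qed.

Lemma cvg_lower_freq (R : realType) (T : finType) (w : nat -> T) (x : T) :
  cvgn (fun n => (min_occ w x n)%:R / n%:R : R).
Proof.
have minle n : (min_occ w x n <= n)%N.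
  have [i <-] := (min_occP w x n).2.
  by rewrite -{2}(size_factor w i n) count_size.
have : cvgn (fun n => (n - min_occ w x n)%:R / n%:R : R).
  apply: fekete => [n|m n]; first exact: leq_subr.
  suff : (min_occ w x m + min_occ w x n <= min_occ w x (m + n))%N.
    move=> H; rewrite addnBAC ?minle // addnBA ?minle // -subnDA leq_sub2l //.
    by rewrite addnC.
  have [i <-] := (min_occP w x (m + n)).2.
  by rewrite factorD count_cat leq_add // (min_occP w x _).1.
move=> /(is_cvgB (is_cvg_cst (1 : R))) /cvg_ex[l ul]; apply/cvg_ex; exists l.
apply: cvg_trans ul; apply: near_eq_cvg; near=> n.
have n0 : n%:R != 0 :> R by rewrite pnatr_eq0 -lt0n; near: n; exists 1%N.
by rewrite !fctE /= natrB // mulrBl divff // subKr.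
Unshelve. all: by end_near. Qed.

(* Main.v *)
From Pilot Require Import Defs.
From mathcomp Require Import all_boot all_order all_algebra.
From mathcomp Require Import all_classical all_reals all_analysis.
From mathcomp Require Import ring lra.
Set Implicit Arguments.
Unset Strict Implicit.
Unset Printing Implicit Defensive.
Import Pilot.Defs.
Import Order.TTheory GRing.Theory Num.Theory numFieldNormedType.Exports.
Local Open Scope ring_scope.

(** To a word [u] give the weight [p * |u| - q * |u|_x].  A short exhaustive
    search shows that, for [(p, q) = (31, 117)] and for [(p, q) = (-39, -97)],
    every position of a ternary square-free word starts a nonempty factor of
    bounded length and nonpositive weight.  Cutting any factor greedily into
    such pieces bounds its weight by a constant, and dividing by the length
    gives [p <= q * f] in the limit. *)

Definition weight (p q : int) (x c : 'I_3) : int := if c == x then p - q else p.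

Lemma sum_weight p q x (u : seq 'I_3) :
  \sum_(c <- u) weight p q x c = p * (size u)%:Z - q * (count_mem x u)%:Z.
Proof.
elim: u => [|c u IH]; first by rewrite big_nil !mulr0 subr0.
by rewrite big_cons IH /weight /= -[(size u).+1]add1n !PoszD; case: eqP => _ /=; ring.
Qed.

(** Meant for reversed words: a letter appended to a square-free word can only create a square as a
    suffix, which is a prefix of the reversal. *)
Definition starts_with_square (T : eqType) (u : seq T) : bool :=
  has (fun k => take k u == take k (drop k u)) (iota 1 (size u)./2).

Lemma starts_with_squareP (T : eqType) (u : seq T) :
  starts_with_square u -> exists2 y, y <> [::] & exists v, u = y ++ y ++ v.
Proof.
case/hasP=> k; rewrite mem_iota add1n ltnS => /andP[k_gt0 kn] /eqP ky.
have ksz : (k <= size u)%N by rewrite (leq_trans kn) // leq_half_double -addnn -addnS leq_addr.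
exists (take k u); last first.
  exists (drop k (drop k u)); rewrite [X in _ ++ X ++ _]ky.
  by rewrite !cat_take_drop.
by move/(congr1 size); rewrite size_takel //= => k0; rewrite k0 in k_gt0.
Qed.

Lemma square_free_factor (T : eqType) (w : nat -> T) i n :
  square_free w -> ~~ starts_with_square (rev (factor w i n)).
Proof.
move=> w_sqf; apply/negP => /starts_with_squareP[y y0 [v fE]].
apply: (w_sqf (rev y)); first by move/(congr1 rev); rewrite revK.
have {}fE : factor w i n = rev v ++ (rev y ++ rev y).
  by rewrite -[LHS]revK fE !rev_cat catA.
exists (i + size v)%N.
have nE : n = (size v + size (rev y ++ rev y))%N.
  by rewrite -(size_factor w i n) fE size_cat size_rev.
move: fE; rewrite {1}nE factorD => /eqP.
by rewrite eqseq_cat ?size_factor ?size_rev // => /andP[_ /eqP].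
Qed.

Definition letters : seq 'I_3 :=
  [:: Ordinal (isT : (0 < 3)%N); Ordinal (isT : (1 < 3)%N);
      Ordinal (isT : (2 < 3)%N)].

Lemma mem_letters c : c \in letters.
Proof. by case: c => [[|[|[|]]]]. Qed.

(* [u] is the word read so far, reversed, and [s] is its weight.  The
   conditional, unlike a disjunction, keeps call-by-value evaluation from
   exploring the pruned branches. *)
Fixpoint turns_nonpos (g : 'I_3 -> int) (d : nat) (s : int) (u : seq 'I_3) :=
  if d is d'.+1 then
    all (fun c => if (s + g c <= 0) || starts_with_square (c :: u) then true
                  else turns_nonpos g d' (s + g c) (c :: u)) letters
  else false.

Lemma factorS (T : Type) (w : nat -> T) i n :
  factor w i n.+1 = rcons (factor w i n) (w (i + n)%N).
Proof. by rewrite -addn1 factorD cats1 /factor /= addn0. Qed.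

Lemma turns_nonposP g d w i n : square_free w ->
  turns_nonpos g d (\sum_(c <- factor w i n) g c) (rev (factor w i n)) ->
  exists2 m, (n < m <= n + d)%N & \sum_(c <- factor w i m) g c <= 0.
Proof.
move=> w_sqf; elim: d n => [//|d IH] n /allP/(_ _ (mem_letters (w (i + n)%N))).
(* The search covers every next letter, hence the actual one; square-freeness of [w] excludes the
   pruned case. *)
rewrite -rev_rcons -factorS (negPf (square_free_factor i n.+1 w_sqf)) orbF.
have -> : \sum_(c <- factor w i n) g c + g (w (i + n)%N) =
          \sum_(c <- factor w i n.+1) g c.
  by rewrite factorS -cats1 big_cat big_seq1.
case: ifP => [le0 _|_ /IH[m /andP[nm md] le0]]; last first.
  by exists m => //; rewrite addnS -addSn md ltnW.
by exists n.+1 => //; rewrite ltnSn addnS ltnS leq_addr.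
Qed.

Lemma sum_factor_bounded (T : Type) (w : nat -> T) (g : T -> int) d (M : int) :
  (forall c, g c <= M) -> 0 <= M ->
  (forall i, exists2 m, (0 < m <= d)%N & \sum_(c <- factor w i m) g c <= 0) ->
  forall n i, \sum_(c <- factor w i n) g c <= M * d%:Z.
Proof.
move=> gM M0 short; elim/ltn_ind => n IH i.
(* A leftover of length at most [d] is bounded letter by letter; otherwise a nonpositive prefix is
   cut off. *)
have [nd|dn] := leqP n d.
  apply: (@le_trans _ _ (\sum_(c <- factor w i n) M)); first exact: ler_sum.
  rewrite big_const_seq count_predT size_factor iter_addr_0 -mulr_natr natz.
  by rewrite ler_wpM2l // lez_nat.
have [m /andP[m0 md] le0] := short i.
have mn := leq_trans md (ltnW dn).
rewrite -(subnKC mn) factorD big_cat /= -[leRHS]add0r lerD // IH //.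
by rewrite ltn_subrL m0 (leq_trans m0).
Qed.

Lemma weight_factor_bounded (p q : int) d (w : nat -> 'I_3) (x : 'I_3) :
  square_free w -> turns_nonpos (weight p q x) d 0 [::] ->
  exists C : int, forall n i,
    p * n%:Z - q * (count_mem x (factor w i n))%:Z <= C.
Proof.
move=> w_sqf search; exists ((`|p| + `|q|) * d%:Z) => n i.
rewrite -{1}(size_factor w i n) -sum_weight.
apply: sum_factor_bounded => [c||j].
- rewrite /weight; case: ifP => _; last by rewrite ler_wpDr ?ler_norm.
  by rewrite lerD ?ler_norm // -normrN ler_norm.
- by rewrite addr_ge0.
- by apply: (@turns_nonposP _ d w j 0%N w_sqf); rewrite /factor big_nil.
Qed.

(** Division by [n] leaves [C / n] on the right, which tends to 0. Negative [p] and [q] are allowed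
    and give upper bounds on the limit. *)
Lemma lim_ratio_ge (R : realType) (a : nat -> nat) (p q C : int) :
  cvgn (fun n => (a n)%:R / n%:R : R) ->
  (forall n, p * n%:Z - q * (a n)%:Z <= C) ->
  p%:~R <= q%:~R * limn (fun n => (a n)%:R / n%:R : R).
Proof.
move=> cva bnd; rewrite -subr_le0.
have cvC : ((fun n => C%:~R / n%:R : R) @ \oo --> (C%:~R * 0 : R))%classic.
  apply: cvgM; first exact: cvg_cst.
  apply/gtr0_cvgV0; last exact: cvgr_idn.
  by near=> n; rewrite ltr0n; near: n; exists 1%N.
rewrite mulr0 in cvC.
have cvL : ((fun n => p%:~R - q%:~R * ((a n)%:R / n%:R) : R) @ \oo -->
    (p%:~R - q%:~R * limn (fun n => (a n)%:R / n%:R : R) : R))%classic.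
  by apply: cvgB; [exact: cvg_cst | apply: cvgM cva; exact: cvg_cst].
apply: (ler_cvg_to cvL cvC); near=> n.
have n0 : 0 < n%:R :> R by rewrite ltr0n; near: n; exists 1%N.
rewrite ler_pdivlMr // mulrBl -!mulrA mulVf ?gt_eqF // mulr1.
have := bnd n; rewrite -(ler_int R) rmorphB !rmorphM /=.
by rewrite -!pmulrn.
Unshelve. all: by end_near. Qed.

(** Here [x] weighs -86 and the other letters 31; every branch ends within 16 letters. *)
Lemma lower_search : all (fun x => turns_nonpos (weight 31 117 x) 16 0 [::]) letters.
Proof. by vm_compute. Qed.

(** Here [x] weighs 58 and the other letters -39. *)
Lemma upper_search :
  all (fun x => turns_nonpos (weight (-39) (-97) x) 16 0 [::]) letters.
Proof. by vm_compute. Qed.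

Theorem theorem2 (R : realType) (w : nat -> 'I_3) (x : 'I_3)
    (w_sqf : square_free w) :
  [/\ 31 / 117 <= lower_freq R w x,
      lower_freq R w x <= upper_freq R w x
    & upper_freq R w x <= 39 / 97].
Proof.
have cvL := @cvg_lower_freq R _ w x; have cvU := @cvg_upper_freq R _ w x.
split.
- have [C bnd] := weight_factor_bounded w_sqf
    (allP lower_search x (mem_letters x)).
  suff : (31%:Z)%:~R <= (117%:Z)%:~R * lower_freq R w x by lra.
  apply: (lim_ratio_ge (C := C) cvL) => n.
  (* The minimum is attained by a factor, to which the uniform bound applies. *)
  by have [i <-] := (min_occP w x n).2.
- apply: ler_lim => //; apply: nearW => n; rewrite ler_wpM2r // ler_nat.
  exact: leq_trans ((min_occP w x n).1 0%N) ((max_occP w x n).1 0%N).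
- have [C bnd] := weight_factor_bounded w_sqf
    (allP upper_search x (mem_letters x)).
  suff : (-39 : int)%:~R <= (-97 : int)%:~R * upper_freq R w x by lra.
  apply: (lim_ratio_ge (C := C) cvU) => n.
  by have [i <-] := (max_occP w x n).2.
Qed.
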